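(* Let $\varphi:MU^*\otimes_{\mathbb{Z}}\mathbb{Q}\to\mathbb{C}$ be any complex-valued genus, with logarithm $\log_\varphi$ and characteristic power series $Q_\varphi(z)=z/\log_\varphi^{-1}(z)$. Then $\varphi$ has a unique representation as an element of the non-commutative probability space $(\tilde{\mathcal E}_1,\tilde\tau_1)$, given by the canonical operator $$A_\varphi=(1+l)\,\frac{1}{Q_\varphi}(l^* )=(1+l)\Big(\frac{\log_\varphi^{-1}(z)}{z}\Big)(l^* );$$ that is, $A_\varphi\in\tilde{\mathcal E}_1$, $\tilde\tau_1(A_\varphi)\neq0$, the $S$-transform of the $\tilde\tau_1$-distribution of $A_\varphi$ equals $Q_\varphi$, and distinct genera give distinct operators $A_\varphi$ (and distinct distributions).
   Context: $MU^*$ is the complex cobordism ring. A complex-valued genus is a ring homomorphism $\varphi:MU^*\otimes_{\mathbb{Z}}\mathbb{Q}\to\mathbb{C}$ with $\varphi(1)=1$. Its logarithm is $\log_\varphi(z)=\sum_{n\ge1}\frac{\varphi(\mathbb{C}P^{n-1})}{n}z^n$ (with $\mathbb{C}P^0:=1$), a power series $z+O(z^2)$, and $\log_\varphi^{-1}$ is its compositional inverse; $Q_\varphi\in1+z\mathbb{C}[[z]]$. Let $l,l^*$ be symbols with $l^*l=1$. $\tilde{\mathcal E}_1$ is the unital algebra of formal series $\sum_{m,n\ge0}\alpha_{mn}l^m(l^* )^n$ with $\alpha_{mn}\in\mathbb{C}$ and $\alpha_{mn}=0$ for almost all $m$, multiplied using $l^*l=1$; $\tilde\tau_1$ is the linear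 functional sending such a series to $\alpha_{00}$. For $f=\sum f_nz^n\in\mathbb{C}[[z]]$, $f(l^* )=\sum f_n(l^* )^n$. The $\tilde\tau_1$-distribution of $a\in\tilde{\mathcal E}_1$ is $\mu_a:\mathbb{C}[X]\to\mathbb{C}$, $\mu_a(X^k)=\tilde\tau_1(a^k)$. For a distribution $\mu$ with $\mu(X)\ne0$, with $M_\mu(z)=\sum_{n\ge1}\mu(X^n)z^n$, the $S$-transform is $S_\mu(z)=\frac{1+z}{z}M_\mu^{-1}(z)$ ($M_\mu^{-1}$ the compositional inverse). *)

(* Defs.v *)
From HB Require Import structures.
From mathcomp Require Import all_boot all_order all_algebra.
From mathcomp Require Import reals.
From mathcomp Require Export complex.
From Stdlib Require Import ClassicalEpsilon.

Set Implicit Arguments.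
Unset Strict Implicit.
Unset Printing Implicit Defensive.
Import Order.TTheory GRing.Theory Num.Theory.
Local Open Scope ring_scope.

Section Defs.
Variable F : fieldType.

Definition series := nat -> F.
Definition sone : series := fun n => (n == 0)%:R.
Definition sX : series := fun n => (n == 1)%:R.
Definition smul (f g : series) : series :=
  fun n => \sum_(i < n.+1) f i * g (n - i)%N.
Definition spow (f : series) (k : nat) : series := iter k (smul f) sone.
(* composition f(g(z)) (meaningful when g 0 = 0) *)
Definition scomp (f g : series) : series :=
  fun n => \sum_(k < n.+1) f k * spow g k n.
(* multiplicative inverse 1/f (exists uniquely when f 0 <> 0) *)
Definition sinv (f : series) : series :=
  epsilon (inhabits sone) (fun g => smul f g = sone).
(* compositional inverse f^{-1} (exists uniquely when f 0 = 0, f 1 <> 0) *)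
Definition is_cinv (f g : series) : Prop :=
  g 0%N = 0 /\ scomp f g = sX /\ scomp g f = sX.
Definition cinv (f : series) : series :=
  epsilon (inhabits sone) (is_cinv f).

(* A genus phi : MU^* (x) Q -> C is encoded by its values
   c n = phi(CP^n) (with c 0 = phi(CP^0) = phi(1) = 1). *)
Definition log_genus (c : nat -> F) : series :=
  fun n => if n is n'.+1 then c n' / n%:R else 0.
(* log_phi^{-1}(z) / z *)
Definition invlog_over_z (c : nat -> F) : series :=
  fun n => cinv (log_genus c) n.+1.
Definition Q_genus (c : nat -> F) : series := sinv (invlog_over_z c).

(* a = sum_{m,n} alpha_{mn} l^m (l^* )^n with finitely many m: stored as the
   finite list of rows (m = 0, 1, ...), row m being n |-> alpha_{mn}. *)
Definition E1 := seq series.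
Definition coefE1 (a : E1) (m n : nat) : F := nth (fun _ => 0) a m n.
(* product using l^* l = 1:
   (l^m l*^n)(l^p l*^q) = l^m l*^(n-p+q) if p <= n, l^(m+p-n) l*^q if n < p *)
Definition emul (a b : E1) : E1 :=
  mkseq (fun M : nat => fun N : nat =>
     \sum_(p < size b) \sum_(q < N.+1)
         coefE1 a M (N + p - q)%N * coefE1 b p q
   + \sum_(p < size b) \sum_(n < p)
         (if (p - n <= M)%N then coefE1 a (M - (p - n))%N n * coefE1 b p N
          else 0))
   (size a + size b).
Definition eone : E1 := [:: sone].
Definition epow (a : E1) (k : nat) : E1 := iter k (emul a) eone.
Definition tau1 (a : E1) : F := coefE1 a 0 0.
Definition ser_lstar (f : series) : E1 := [:: f].
Definition one_plus_l : E1 := [:: sone; sone].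

Definition distr (a : E1) (p : {poly F}) : F :=
  \sum_(i < size p) p`_i * tau1 (epow a i).
Definition moment_series (mu : {poly F} -> F) : series :=
  fun n => if n is 0 then 0 else mu ('X^n).
(* S_mu(z) = (1+z)/z * M_mu^{-1}(z) *)
Definition Stransform (mu : {poly F} -> F) : series :=
  fun n => cinv (moment_series mu) n.+1 + cinv (moment_series mu) n.

Definition A_genus (c : nat -> F) : E1 :=
  emul one_plus_l (ser_lstar (invlog_over_z c)).
End Defs.

(* Main.v *)
Require Import Defs.
From mathcomp Require Import all_boot all_order all_algebra.
From mathcomp Require Import reals complex.
From mathcomp Require Import zify ring.
From Stdlib Require Import ClassicalEpsilon Classical FunctionalExtensionality.
Import GRing.Theory Num.Theory.
Local Open Scope ring_scope.

(* Write g = log^{-1}(z)/z.  Both rows 0 and 1 of A = (1 + l) g(l^* ) equal g,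
   so the column A^k e_0 obeys a linear recursion in k, and the generating
   functions P_j(w) = sum_k (A^k)_{j0} w^k solve a fixed-point system
   P_j = [j = 0] + w sum_p a_{jp} P_p.  Since w has no constant term, this system
   has a unique solution.  For w = z / ((1 + z) g(z)) it is also solved by
   (1 + z) z^j, so sum_k tau(A^k) w^k = 1 + z: the moment series M satisfies
   M(w) = z, hence M^{-1} = w and S = (1 + z)/z * w = 1/g = Q.
   Distinct genera give distinct g (g determines log, hence every phi(CP^n), in
   characteristic 0), hence distinct row 0 of A and distinct Q = S. *)

Section PolyModX.
Context {F : fieldType}.
Implicit Types p q : {poly F}.

Definition eqm (m : nat) p q := forall i, (i < m)%N -> p`_i = q`_i.

Lemma eqm_refl {m p} : eqm m p p. Proof. by []. Qed.

Lemma eqm_sym {m p q} : eqm m p q -> eqm m q p.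
Proof. by move=> h i /h ->. Qed.

Lemma eqm_trans {m p} q {r} : eqm m p q -> eqm m q r -> eqm m p r.
Proof. by move=> h1 h2 i hi; rewrite h1 // h2. Qed.

Lemma eqm_le {m m' p q} : (m' <= m)%N -> eqm m p q -> eqm m' p q.
Proof. by move=> hm h i hi; apply: h; apply: leq_trans hm. Qed.

Lemma eqmD {m p q p' q'} : eqm m p p' -> eqm m q q' -> eqm m (p + q) (p' + q').
Proof. by move=> h1 h2 i hi; rewrite !coefD h1 // h2. Qed.

Lemma eqmZ {m} a {p q} : eqm m p q -> eqm m (a *: p) (a *: q).
Proof. by move=> h i hi; rewrite !coefZ h. Qed.

Lemma eqm_sum {m n} {P Q : 'I_n -> {poly F}} : (forall i, eqm m (P i) (Q i)) ->
  eqm m (\sum_(i < n) P i) (\sum_(i < n) Q i).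
Proof. by move=> h i hi; rewrite !coef_sum; apply: eq_bigr => j _; apply: h. Qed.

Lemma eqmM {m p q p' q'} : eqm m p p' -> eqm m q q' -> eqm m (p * q) (p' * q').
Proof.
move=> h1 h2 i hi; rewrite !coefM; apply: eq_bigr => [[j hj]] _ /=.
by rewrite h1 ?h2 //; lia.
Qed.

Lemma eqm_mulX0 {m} (c : {poly F}) {p q} : c`_0 = 0 -> eqm m p q -> eqm m.+1 (c * p) (c * q).
Proof.
move=> c0 h i hi; rewrite !coefM; apply: eq_bigr => [[[|j] hj]] _ /=.
  by rewrite c0 !mul0r.
by rewrite h //; lia.
Qed.

Lemma eqmX {m p q} k : eqm m p q -> eqm m (p ^+ k) (q ^+ k).
Proof. by move=> h; elim: k => [|k IH]; rewrite ?expr0 // !exprS; apply: eqmM. Qed.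

Lemma sum_ord_vanishing (G : nat -> F) n m : (n <= m)%N ->
  (forall i, (n <= i < m)%N -> G i = 0) -> \sum_(i < m) G i = \sum_(i < n) G i.
Proof.
move=> hnm hG; rewrite (big_ord_widen m G hnm) [RHS]big_mkcond.
apply: eq_bigr => i _; case: ifPn => // /negbTE hi; apply: hG.
by rewrite ltn_ord andbT leqNgt hi.
Qed.

Lemma sum_ord_pick n c (x : nat -> F) :
  \sum_(i < n) (if (i : nat) == c then x i else 0) = if (c < n)%N then x c else 0.
Proof.
elim: n => [|n IH]; first by rewrite big_ord0.
rewrite big_ord_recr /= IH.
case: (ltngtP c n) => [h|h|->].
- by rewrite ltnS ltnW // addr0.
- by rewrite ltnS leqNgt h addr0.
- by rewrite ltnSn add0r.
Qed.

Lemma coef_monomial_rec (P : nat -> {poly F}) (a : nat -> F) : P 0%N = 0 ->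
  (forall N, P N.+1 = P N + a N *: 'X^N) ->
  forall N i, (P N)`_i = if (i < N)%N then a i else 0.
Proof.
move=> P0 PS; elim=> [|N IH] i; first by rewrite P0 coef0.
rewrite PS coefD coefZ coefXn IH.
case: (ltngtP i N) => [hlt|hgt|->].
- by rewrite ltnS ltnW // mulr0 addr0.
- by rewrite ltnS leqNgt hgt mulr0 addr0.
- by rewrite ltnSn mulr1 add0r.
Qed.

Lemma coef_expr_lt q k n : q`_0 = 0 -> (n < k)%N -> (q ^+ k)`_n = 0.
Proof.
move=> q0; elim: k n => [//|k IH] n hn; rewrite exprS coefM.
apply: big1 => [[[|j] hj]] _ /=; first by rewrite q0 mul0r.
by rewrite IH ?mulr0 //; lia.
Qed.

Lemma coef_expr_diag q k : q`_0 = 0 -> (q ^+ k)`_k = q`_1 ^+ k.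
Proof.
move=> q0; elim: k => [|k IH]; first by rewrite !expr0 coef1.
rewrite exprS coefM big_ord_recl /= q0 mul0r add0r.
rewrite big_ord_recl /= subSS subn0 IH -exprS big1 ?addr0 // => [[j hj]] _ /=.
by rewrite coef_expr_lt ?mulr0 //; rewrite /bump /=; lia.
Qed.

Lemma coef_comp_poly_X0 p q n : q`_0 = 0 ->
  (p \Po q)`_n = \sum_(i < n.+1) p`_i * (q ^+ i)`_n.
Proof.
move=> q0; rewrite coef_comp_poly.
set G := fun i => p`_i * (q ^+ i)`_n.
rewrite -(@sum_ord_vanishing G (size p) (size p + n.+1)).
- rewrite (@sum_ord_vanishing G n.+1) ?leq_addl // => i /andP[h1 _].
  by rewrite /G coef_expr_lt ?mulr0.
- exact: leq_addr.
- by move=> i /andP[h _]; rewrite /G nth_default ?mul0r.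
Qed.

Lemma eqm_comp {m p p' q q'} : eqm m p p' -> eqm m q q' -> q`_0 = 0 -> q'`_0 = 0 ->
  eqm m (p \Po q) (p' \Po q').
Proof.
move=> hp hq q0 q'0 n hn; rewrite !coef_comp_poly_X0 //.
apply: eq_bigr => [[i hi]] _ /=.
by rewrite hp ?(eqmX i hq) //; apply: leq_ltn_trans hn.
Qed.

(* [W] has no constant term, so the right-hand side determines the coefficients
   of [P j] one order beyond those it is given. *)
Lemma eqm_fixpoint_uniq {m K} {W : {poly F}} {a : nat -> nat -> F} {d P Q : nat -> {poly F}} :
  W`_0 = 0 ->
  (forall j, eqm m (P j) (d j + W * \sum_(p < K) a j p *: P p)) ->
  (forall j, eqm m (Q j) (d j + W * \sum_(p < K) a j p *: Q p)) ->
  forall j, eqm m (P j) (Q j).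
Proof.
move=> W0 hP hQ.
suff H m' j : (m' <= m)%N -> eqm m' (P j) (Q j) by move=> j; apply: H.
elim: m' j => [//|m' IH] j hm.
apply: (eqm_trans _ (eqm_le hm (hP j))); apply: (eqm_trans _ _ (eqm_sym (eqm_le hm (hQ j)))).
apply: (eqmD eqm_refl); apply: (eqm_mulX0 _ W0).
by apply: eqm_sum => p; apply: eqmZ; apply: IH; lia.
Qed.

End PolyModX.

Section Truncation.
Context {F : fieldType}.
Implicit Types f g h : series F.

Definition strunc (K : nat) f : {poly F} := \poly_(i < K) f i.

Lemma coef_strunc K f i : (strunc K f)`_i = if (i < K)%N then f i else 0.
Proof. exact: coef_poly. Qed.

Lemma spow_strunc K f k n : (n < K)%N -> spow f k n = (strunc K f ^+ k)`_n.
Proof.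
elim: k n => [|k IH] n hn; first by rewrite expr0 coef1.
rewrite exprS coefM /spow iterS -/(spow f k); apply: eq_bigr => [[j hj]] _ /=.
by rewrite coef_strunc IH ?ifT //; lia.
Qed.

Lemma smul_strunc K f h n : (n < K)%N -> smul f h n = (strunc K f * strunc K h)`_n.
Proof.
move=> hn; rewrite coefM; apply: eq_bigr => [[j hj]] _ /=.
by rewrite !coef_strunc !ifT //; lia.
Qed.

Lemma eqm_strunc_smul K f h : eqm K (strunc K (smul f h)) (strunc K f * strunc K h).
Proof. by move=> i hi; rewrite coef_strunc hi (smul_strunc _ _ _ _ hi). Qed.

Lemma scomp_strunc K f h n : h 0%N = 0 -> (n < K)%N ->
  scomp f h n = (strunc K f \Po strunc K h)`_n.
Proof.
move=> h0 hn; rewrite coef_comp_poly_X0; last by rewrite coef_strunc h0; case: ifP.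
apply: eq_bigr => [[i hi]] _ /=.
by rewrite coef_strunc ifT ?(spow_strunc _ _ _ _ hn) //; lia.
Qed.

Lemma strunc_sX K : (1 < K)%N -> strunc K (sX F) = 'X.
Proof.
move=> hK; apply/polyP => i; rewrite coef_strunc coefX /sX.
by case: ifP => // hi; case: eqP => // ei; move: hi; rewrite ei hK.
Qed.

End Truncation.

Section SeriesAlgebra.
Context {F : fieldType}.
Implicit Types (f g h : series F).

Lemma scomp0 f h : scomp f h 0%N = f 0%N.
Proof. by rewrite /scomp big_ord1 /= /sone /= mulr1. Qed.

Lemma scomp1 f h : scomp f h 1%N = f 1%N * h 1%N.
Proof.
rewrite /scomp big_ord_recr big_ord1 /= /sone /= mulr0 add0r; congr (_ * _).
by rewrite /spow /= /smul big_ord_recr big_ord1 /= /sone /= mulr0 add0r mulr1.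
Qed.

Lemma scomp_sXl h : h 0%N = 0 -> scomp (sX F) h = h.
Proof.
move=> h0; apply: functional_extensionality => n.
by rewrite (scomp_strunc n.+2) // strunc_sX // comp_polyX coef_strunc ltnW.
Qed.

Lemma scomp_sXr f : scomp f (sX F) = f.
Proof.
apply: functional_extensionality => n.
by rewrite (scomp_strunc n.+2) // strunc_sX // comp_polyXr coef_strunc ltnW.
Qed.

Lemma scompA f g h : g 0%N = 0 -> h 0%N = 0 -> scomp f (scomp g h) = scomp (scomp f g) h.
Proof.
move=> g0 h0; apply: functional_extensionality => n.
have gh0 : scomp g h 0%N = 0 by rewrite scomp0.
have strunc0 k : (strunc n.+1 k)`_0 = k 0%N by rewrite coef_strunc.
have Egh : eqm n.+1 (strunc n.+1 (scomp g h)) (strunc n.+1 g \Po strunc n.+1 h).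
  by move=> i hi; rewrite coef_strunc hi (scomp_strunc _ _ _ _ h0 hi).
have Efg : eqm n.+1 (strunc n.+1 (scomp f g)) (strunc n.+1 f \Po strunc n.+1 g).
  by move=> i hi; rewrite coef_strunc hi (scomp_strunc _ _ _ _ g0 hi).
have ghX0 : (strunc n.+1 g \Po strunc n.+1 h)`_0 = 0 by rewrite -Egh // strunc0.
rewrite (scomp_strunc n.+1 f) // (scomp_strunc n.+1 (scomp f g)) //.
rewrite (eqm_comp eqm_refl Egh _ ghX0 n (ltnSn n)) ?strunc0 // comp_polyA.
by rewrite (eqm_comp Efg eqm_refl _ _ n (ltnSn n)) ?strunc0.
Qed.

Lemma smulC f h : smul f h = smul h f.
Proof.
by apply: functional_extensionality => n; rewrite !(smul_strunc n.+1) // mulrC.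
Qed.

Lemma smulfI f : f 0%N != 0 -> injective (smul f).
Proof.
move=> f0 x y e.
suff H n i : (i <= n)%N -> x i = y i by apply: functional_extensionality => i; apply: (H i).
elim: n i => [|n IH] i hi.
  move: hi; rewrite leqn0 => /eqP ->.
  by have := congr1 (fun s => s 0%N) e; rewrite /smul !big_ord1 => /(mulfI f0).
rewrite leq_eqVlt in hi; case/orP: hi => [/eqP->|hi]; last exact: IH.
have := congr1 (fun s => s n.+1) e; rewrite /smul big_ord_recl [RHS]big_ord_recl /=.
rewrite !subn0 (eq_bigr (fun j : 'I_n.+1 => f (bump 0 j) * y (n.+1 - bump 0 j)%N)).
  by move=> /addIr/(mulfI f0).
by move=> j _; rewrite IH // /bump; lia.
Qed.

(* Each new coefficient is chosen to fix the [X^m] coefficient of the product;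
   the earlier ones are not affected. *)
Fixpoint minv_poly f (n : nat) : {poly F} :=
  if n is m.+1 then
    minv_poly f m + ((sone F m - (strunc m.+1 f * minv_poly f m)`_m) / f 0%N) *: 'X^m
  else 0.

Definition minv f : series F := fun n => (minv_poly f n.+1)`_n.

Lemma strunc_minv f N : strunc N (minv f) = minv_poly f N.
Proof.
have rec := coef_monomial_rec (minv_poly f)
  (fun m => (sone F m - (strunc m.+1 f * minv_poly f m)`_m) / f 0%N) erefl (fun _ => erefl).
by apply/polyP => i; rewrite coef_strunc /minv !rec ltnSn; case: ifP.
Qed.

Lemma coef_mul_minv_poly f N n K : f 0%N != 0 -> (n < N)%N -> (n < K)%N ->
  (strunc K f * minv_poly f N)`_n = sone F n.
Proof.
move=> f0; elim: N n => [//|N IH] n hn hK.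
rewrite /= mulrDr -scalerAr coefD coefZ coefMXn.
rewrite ltnS leq_eqVlt in hn; case/orP: hn => [/eqP en|hn]; last first.
  by rewrite hn mulr0 addr0 IH.
subst n; rewrite ltnn subnn coef_strunc ifT; last by lia.
have E : eqm N.+1 (strunc K f) (strunc N.+1 f).
  by move=> i hi; rewrite !coef_strunc hi ifT //; lia.
by rewrite divfK // (eqmM E eqm_refl N (ltnSn N)) addrC subrK.
Qed.

Lemma smul_minv f : f 0%N != 0 -> smul f (minv f) = sone F.
Proof.
move=> f0; apply: functional_extensionality => n.
by rewrite (smul_strunc n.+1) // strunc_minv coef_mul_minv_poly.
Qed.

Lemma smul_sinv f : f 0%N != 0 -> smul f (sinv f) = sone F.
Proof.
move=> f0; apply: (epsilon_spec (inhabits (sone F)) (fun g => smul f g = sone F)).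
by exists (minv f); apply: smul_minv.
Qed.

(* As for [minv_poly]: the new coefficient fixes the [X^m] coefficient of the
   composition, the earlier ones are not affected because [f 0 = 0]. *)
Fixpoint lcinv_poly f (n : nat) : {poly F} :=
  if n is m.+1 then
    lcinv_poly f m +
      ((sX F m - (lcinv_poly f m \Po strunc m.+1 f)`_m) / f 1%N ^+ m) *: 'X^m
  else 0.

Definition lcinv f : series F := fun n => (lcinv_poly f n.+1)`_n.

Lemma strunc_lcinv f N : strunc N (lcinv f) = lcinv_poly f N.
Proof.
have rec := coef_monomial_rec (lcinv_poly f)
  (fun m => (sX F m - (lcinv_poly f m \Po strunc m.+1 f)`_m) / f 1%N ^+ m)
  erefl (fun _ => erefl).
by apply/polyP => i; rewrite coef_strunc /lcinv !rec ltnSn; case: ifP.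
Qed.

Lemma coef_lcinv_poly_comp f N n K : f 0%N = 0 -> f 1%N != 0 -> (n < N)%N -> (n < K)%N ->
  (lcinv_poly f N \Po strunc K f)`_n = sX F n.
Proof.
move=> f0 f1; elim: N n => [//|N IH] n hn hK.
have T0 : (strunc K f)`_0 = 0 by rewrite coef_strunc f0; case: ifP.
rewrite /= comp_polyD comp_polyZ comp_Xn_poly coefD coefZ.
rewrite ltnS leq_eqVlt in hn; case/orP: hn => [/eqP en|hn]; last first.
  by rewrite coef_expr_lt // mulr0 addr0 IH.
subst n; rewrite coef_expr_diag //.
have -> : (strunc K f)`_1 ^+ N = f 1%N ^+ N.
  by case: N {IH} hK => [|N] hK; rewrite ?expr0 // coef_strunc ifT //; lia.
have E : eqm N.+1 (strunc K f) (strunc N.+1 f).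
  by move=> i hi; rewrite !coef_strunc hi ifT //; lia.
rewrite divfK ?expf_neq0 // (eqm_comp eqm_refl E T0) ?coef_strunc //.
by rewrite addrC subrK.
Qed.

Lemma scomp_lcinv f : f 0%N = 0 -> f 1%N != 0 -> scomp (lcinv f) f = sX F.
Proof.
move=> f0 f1; apply: functional_extensionality => n.
by rewrite (scomp_strunc n.+1) // strunc_lcinv coef_lcinv_poly_comp.
Qed.

(* A left inverse [L] of [f] has itself a left inverse, which must be [f]
   by associativity; so [L] is a two-sided inverse. *)
Lemma exists_cinv f : f 0%N = 0 -> f 1%N != 0 -> exists g, is_cinv f g.
Proof.
move=> f0 f1; set L := lcinv f.
have hL := scomp_lcinv _ f0 f1.
have L0 : L 0%N = 0 by rewrite -(scomp0 L f) hL.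
have L1 : L 1%N != 0.
  by apply: contra_eq_neq (scomp1 L f) => ->; rewrite hL mul0r /sX /= oner_neq0.
have LL : lcinv L = f.
  by rewrite -[LHS]scomp_sXr -hL scompA // scomp_lcinv // scomp_sXl.
by exists L; split; rewrite // -{1}LL scomp_lcinv.
Qed.

Lemma cinvP f : f 0%N = 0 -> f 1%N != 0 -> is_cinv f (cinv f).
Proof. by move=> f0 f1; apply: epsilon_spec; apply: exists_cinv. Qed.

Lemma cinv_eq f g : f 0%N = 0 -> f 1%N != 0 -> g 0%N = 0 -> scomp f g = sX F ->
  cinv f = g.
Proof.
move=> f0 f1 g0 fg; have [_ [_ cf]] := cinvP _ f0 f1.
by rewrite -[g]scomp_sXl // -cf -scompA // fg scomp_sXr.
Qed.

Lemma scomp_sX_inj f g h : h 0%N = 0 -> h 1%N != 0 ->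
  scomp f h = sX F -> scomp g h = sX F -> f = g.
Proof.
move=> h0 h1 fh gh; have [k0 [hk _]] := cinvP _ h0 h1.
by rewrite -(scomp_sXr f) -(scomp_sXr g) -hk !scompA // fh gh.
Qed.

Lemma sinv_inj f g : f 0%N != 0 -> g 0%N != 0 -> sinv f = sinv g -> f = g.
Proof.
move=> f0 g0 e; have fi := smul_sinv _ f0; have gi := smul_sinv _ g0.
have fi0 : sinv f 0%N != 0.
  apply: contra_eq_neq (congr1 (fun s => s 0%N) fi); rewrite /smul big_ord1 => ->.
  by rewrite mulr0 /sone /= eq_sym oner_neq0.
by apply: (smulfI _ fi0); rewrite smulC fi smulC e gi.
Qed.

End SeriesAlgebra.

Section E1Algebra.
Context {F : fieldType}.

Lemma distr_Xn (a : E1 F) k : distr a 'X^k = tau1 (epow a k).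
Proof.
rewrite /distr size_polyXn big_ord_recr /= coefXn eqxx mul1r big1 ?add0r // => i _.
by rewrite coefXn (ltn_eqF (ltn_ord i)) mul0r.
Qed.

Lemma coefE1_out (a : E1 F) m n : (size a <= m)%N -> coefE1 a m n = 0.
Proof. by move=> h; rewrite /coefE1 nth_default. Qed.

Lemma size_emul (a b : E1 F) : size (emul a b) = (size a + size b)%N.
Proof. by rewrite size_mkseq. Qed.

(* The coefficient of [l^M] in [a l^p], using [l^* l = 1]. *)
Definition mul_lpow_coef (a : E1 F) (M p : nat) : F :=
  coefE1 a M p + \sum_(n < p) (if (p - n <= M)%N then coefE1 a (M - (p - n))%N n else 0).

Lemma coefE1_emul_col0 (a b : E1 F) M :
  coefE1 (emul a b) M 0 = \sum_(p < size b) coefE1 b p 0 * mul_lpow_coef a M p.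
Proof.
case: (ltnP M (size a + size b)) => hM.
- rewrite {1}/coefE1 /emul nth_mkseq //; cbv beta.
  rewrite -big_split; apply: eq_bigr => p _.
  rewrite big_ord1 add0n subn0 /mul_lpow_coef mulrDr mulr_sumr mulrC; congr (_ + _).
  by apply: eq_bigr => n _; case: ifP => _; rewrite ?mulr0 // mulrC.
- rewrite coefE1_out ?size_emul //; symmetry; apply: big1 => [[p hp]] _ /=.
  rewrite /mul_lpow_coef (coefE1_out a M p) ?add0r; last by lia.
  rewrite big1 ?mulr0 // => [[n hn]] _ /=; case: ifP => // _.
  by rewrite coefE1_out //; lia.
Qed.

End E1Algebra.

Section CanonicalOperator.
Context {F : fieldType}.
Variable g : series F.

Definition Aop : E1 F := emul (one_plus_l F) (ser_lstar g).

Lemma coefE1_Aop m n : coefE1 Aop m n = if (m < 2)%N then g n else 0.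
Proof.
have coef_opl : forall m' k, coefE1 (one_plus_l F) m' k = if (m' < 2)%N then sone F k else 0.
  by move=> [|[|m']] k //; rewrite coefE1_out.
case: (ltnP m 3) => hm; last by rewrite coefE1_out ?size_emul //; case: ifP => //; lia.
rewrite {1}/coefE1 /emul nth_mkseq //= !big_ord1 big_ord0 addr0 addn0.
rewrite (eq_bigr (fun q : 'I_n.+1 => (if (m < 2)%N then sone F (n - q)%N else 0) * g q));
  last by move=> q _; rewrite coef_opl.
case: ifP => _; last by rewrite big1 // => q _; rewrite mul0r.
rewrite big_ord_recr /= subnn /sone eqxx mul1r big1 ?add0r // => [[q hq]] _ /=.
by rewrite subn_eq0 leqNgt hq mul0r.
Qed.

Lemma mul_lpow_coef_Aop j m : mul_lpow_coef Aop j m =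
  (if (j <= m)%N then g (m - j)%N else 0) +
  (if (0 < j)%N && (j <= m.+1)%N then g (m.+1 - j)%N else 0).
Proof.
rewrite /mul_lpow_coef coefE1_Aop.
rewrite (eq_bigr (fun n : 'I_m =>
   (if (0 < j <= m)%N then (if (n : nat) == (m - j)%N then g n else 0) else 0) +
   (if (1 < j <= m.+1)%N then (if (n : nat) == (m.+1 - j)%N then g n else 0) else 0)));
  last first.
  move=> [n hn] _ /=; rewrite coefE1_Aop.
  by do ?(case: ifPn => ?); rewrite ?addr0 ?add0r //; lia.
have pick (P : bool) c : \sum_(i < m) (if P then (if (i : nat) == c then g i else 0) else 0) =
   if P then (if (c < m)%N then g c else 0) else 0.
  by case: P; [rewrite sum_ord_pick | rewrite big1].
rewrite big_split /= !pick.
case: j => [|[|j]] /=.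
- by rewrite subn0 !addr0.
- rewrite addr0 addrC subSS subn0; congr (_ + _).
  by case: ifP => // h; rewrite ifT //; lia.
- rewrite add0r; congr (_ + _); by case: ifP => // h; rewrite ifT //; lia.
Qed.

Definition col0_pow k j := coefE1 (epow Aop k) j 0.

Lemma size_epow_Aop k : size (epow Aop k) = (3 * k).+1.
Proof.
elim: k => // k IH.
by rewrite /epow iterS -/(epow Aop k) size_emul IH /Aop size_emul /=; lia.
Qed.

Lemma col0_pow0 j : col0_pow 0 j = (j == 0%N)%:R.
Proof. by case: j => [|j] //; rewrite /col0_pow coefE1_out. Qed.

Lemma col0_powS k K j : ((3 * k).+1 <= K)%N ->
  col0_pow k.+1 j = \sum_(p < K) mul_lpow_coef Aop j p * col0_pow k p.
Proof.
move=> hK; rewrite /col0_pow /epow iterS -/(epow Aop k).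
rewrite coefE1_emul_col0 size_epow_Aop.
rewrite (sum_ord_vanishing (fun p => mul_lpow_coef Aop j p * coefE1 (epow Aop k) p 0) _ _ hK).
  by apply: eq_bigr => p _; rewrite mulrC.
by move=> i /andP[h1 _]; rewrite coefE1_out ?mulr0 // size_epow_Aop.
Qed.

Definition moment_gf N (W : {poly F}) j : {poly F} := \sum_(k < N.+1) col0_pow k j *: W ^+ k.

Lemma moment_gf_fixpoint N K (W : {poly F}) j : W`_0 = 0 -> (3 * N < K)%N ->
  eqm N.+1 (moment_gf N W j)
    ((j == 0%N)%:R%:P + W * \sum_(p < K) mul_lpow_coef Aop j p *: moment_gf N W p).
Proof.
move=> W0 hK.
have -> : W * \sum_(p < K) mul_lpow_coef Aop j p *: moment_gf N W p =
    \sum_(k < N.+1) (\sum_(p < K) mul_lpow_coef Aop j p * col0_pow k p) *: W ^+ k.+1.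
  rewrite mulr_sumr (eq_bigr (fun p : 'I_K => \sum_(k < N.+1)
      (mul_lpow_coef Aop j p * col0_pow k p) *: W ^+ k.+1)).
    by rewrite exchange_big; apply: eq_bigr => k _; rewrite scaler_suml.
  move=> p _; rewrite /moment_gf -scalerAr mulr_sumr scaler_sumr.
  by apply: eq_bigr => k _; rewrite -scalerAr -exprS scalerA.
rewrite /moment_gf big_ord_recl col0_pow0 expr0 alg_polyC big_ord_recr /= addrA.
rewrite (eq_bigr (fun k : 'I_N => (\sum_(p < K) mul_lpow_coef Aop j p * col0_pow k p)
    *: W ^+ k.+1)); last by move=> [k hk] _; rewrite /= (col0_powS _ _ j (_ : _ <= K)%N) //; lia.
by move=> i hi; rewrite [in RHS]coefD coefZ coef_expr_lt // mulr0 addr0.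
Qed.

Lemma mulXn_onePX_fixpoint K (W : {poly F}) j : eqm K (W * ((1 + 'X) * strunc K g)) 'X ->
  eqm K ((1 + 'X) * 'X^j)
    ((j == 0%N)%:R%:P + W * \sum_(p < K) mul_lpow_coef Aop j p *: ((1 + 'X) * 'X^p)).
Proof.
move=> hW.
have -> : \sum_(p < K) mul_lpow_coef Aop j p *: ((1 + 'X) * 'X^p) =
    (1 + 'X) * \poly_(p < K) mul_lpow_coef Aop j p.
  by rewrite poly_def mulr_sumr; apply: eq_bigr => p _; rewrite scalerAr.
pose B : {poly F} := if j is j'.+1 then 'X^j + 'X^j' else 1.
have EB : eqm K (\poly_(p < K) mul_lpow_coef Aop j p) (B * strunc K g).
  move=> i hi; rewrite coef_poly hi mul_lpow_coef_Aop /B.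
  case: j {B} => [|j'] /=; first by rewrite mul1r coef_strunc hi subn0 addr0.
  rewrite mulrDl coefD !coefXnM !coef_strunc subSS.
  by congr (_ + _); do ?(case: ifPn => ?); rewrite //; lia.
have -> : (1 + 'X) * 'X^j = (j == 0%N)%:R%:P + B * 'X.
  by rewrite /B; case: j {EB B} => [|j'] /=; rewrite ?expr0 ?mulr1 ?mul1r ?polyC1 //
    polyC0 add0r !exprS; ring.
apply: (eqmD eqm_refl); apply: eqm_sym; apply: (eqm_trans _ (eqmM eqm_refl (eqmM eqm_refl EB))).
have -> : W * ((1 + 'X) * (B * strunc K g)) = B * (W * ((1 + 'X) * strunc K g)) by ring.
exact: (eqmM eqm_refl hW).
Qed.

Lemma scomp_moment_series_Aop w : w 0%N = 0 ->
  (forall K, eqm K (strunc K w * ((1 + 'X) * strunc K g)) 'X) ->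
  scomp (moment_series (distr Aop)) w = sX F.
Proof.
move=> w0 hw; apply: functional_extensionality => n.
pose K := (3 * n).+2; pose W := strunc K w.
have W0 : W`_0 = 0 by rewrite coef_strunc.
have hK : (3 * n < K)%N by exact: leqW (leqnn _).
have hnK : (n.+1 <= K)%N by rewrite /K; lia.
have := eqm_fixpoint_uniq W0 (fun j => moment_gf_fixpoint n K W j W0 hK)
  (fun j => eqm_le hnK (mulXn_onePX_fixpoint K W j (hw K))) 0%N n (ltnSn n).
rewrite /moment_gf coef_sum expr0 mulr1 coefD coef1 coefX.
rewrite (eq_bigr (fun k : 'I_n.+1 => tau1 (epow Aop k) * spow w k n)) => [|k _]; last first.
  by rewrite coefZ (spow_strunc K).
rewrite /scomp !big_ord_recl mul0r add0r [tau1 _]/= mul1r /sX => /addrI <-.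
by apply: eq_bigr => k _; rewrite /= distr_Xn.
Qed.

(* With [h = (1 + z) g], the series [w = z / h] inverts the moment series, so
   [S = (1 + z) / z * w = 1 / g]. *)
Lemma Stransform_Aop : g 0%N != 0 -> Stransform (distr Aop) = sinv g.
Proof.
move=> g0.
pose onez : series F := fun n => (n == 0%N)%:R + (n == 1%N)%:R.
pose h := smul onez g; pose u := sinv h.
pose w : series F := fun n => if n is n'.+1 then u n' else 0.
have h0 : h 0%N != 0 by rewrite /h /smul big_ord1 /onez /= addr0 mul1r.
have Eh K : eqm K ((1 + 'X) * strunc K g) (strunc K h).
  apply: eqm_sym; apply: (eqm_trans _ (eqm_strunc_smul K onez g)).
  by apply: (eqmM _ eqm_refl) => i hi; rewrite coef_strunc hi coefD coef1 coefX.
have Ehu K : eqm K (strunc K h * strunc K u) 1.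
  apply: (eqm_trans _ (eqm_sym (eqm_strunc_smul K h u))).
  by move=> i hi; rewrite smul_sinv // coef_strunc hi coef1.
have Ew K : eqm K (strunc K w) ('X * strunc K u).
  by move=> [|i] hi; rewrite coef_strunc hi coefXM //= coef_strunc ifT //; lia.
have hw K : eqm K (strunc K w * ((1 + 'X) * strunc K g)) 'X.
  apply: (eqm_trans _ (eqmM (Ew K) (Eh K))).
  have -> : 'X * strunc K u * strunc K h = 'X * (strunc K h * strunc K u) by ring.
  by rewrite -[X in eqm _ _ X]mulr1; apply: (eqmM eqm_refl (Ehu K)).
set M := moment_series (distr Aop).
have Mw : scomp M w = sX F by apply: scomp_moment_series_Aop.
have M1 : M 1%N != 0.
  by apply: contra_eq_neq (scomp1 M w) => ->; rewrite Mw mul0r /sX /= oner_neq0.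
have Mi : cinv M = w by apply: cinv_eq.
apply: (smulfI _ g0); rewrite smul_sinv //.
apply: functional_extensionality => n; rewrite (smul_strunc n.+1) //.
have ES : eqm n.+1 (strunc n.+1 (Stransform (distr Aop))) ((1 + 'X) * strunc n.+1 u).
  move=> i hi; rewrite coef_strunc hi /Stransform -/M Mi mulrDl mul1r coefD coefXM.
  by case: i hi => [|i] hi /=; rewrite !coef_strunc; do ?(case: ifPn => ?); rewrite ?addr0 //; lia.
rewrite (eqmM eqm_refl ES n (ltnSn n)).
have -> : strunc n.+1 g * ((1 + 'X) * strunc n.+1 u) =
    ((1 + 'X) * strunc n.+1 g) * strunc n.+1 u by ring.
by rewrite (eqmM (Eh n.+1) eqm_refl n (ltnSn n)) (Ehu n.+1 n (ltnSn n)) coef1.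
Qed.

End CanonicalOperator.

Section Genus.
Context {F : fieldType}.
Implicit Types c : nat -> F.

Lemma A_genusE c : A_genus c = Aop (invlog_over_z c).
Proof. by []. Qed.

Lemma coefE1_A_genus c m n :
  coefE1 (A_genus c) m n = if (m < 2)%N then invlog_over_z c n else 0.
Proof. exact: coefE1_Aop. Qed.

Lemma log_genus0 c : log_genus c 0%N = 0.
Proof. by []. Qed.

Lemma log_genus1 c : c 0%N = 1 -> log_genus c 1%N = 1.
Proof. by move=> c0; rewrite /log_genus /= c0 divr1. Qed.

Lemma invlog_over_z0 c : c 0%N = 1 -> invlog_over_z c 0%N = 1.
Proof.
move=> c0; have l1 : log_genus c 1%N != 0 by rewrite log_genus1 ?oner_neq0.
have [_ [lc _]] := cinvP _ (log_genus0 c) l1.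
by have := scomp1 (log_genus c) (cinv (log_genus c)); rewrite lc log_genus1 // mul1r.
Qed.

(* Dividing by [n + 1] in [log_genus] needs characteristic 0. *)
Lemma invlog_over_z_inj c c' : (forall n, n.+1%:R != 0 :> F) ->
  c 0%N = 1 -> c' 0%N = 1 -> invlog_over_z c = invlog_over_z c' -> c = c'.
Proof.
move=> hchar c0 c'0 e.
have l1 : log_genus c 1%N != 0 by rewrite log_genus1 ?oner_neq0.
have l1' : log_genus c' 1%N != 0 by rewrite log_genus1 ?oner_neq0.
have [G0 [lG _]] := cinvP _ (log_genus0 c) l1.
have [G0' [lG' _]] := cinvP _ (log_genus0 c') l1'.
have eG : cinv (log_genus c') = cinv (log_genus c).
  apply: functional_extensionality => [[|n]]; first by rewrite G0 G0'.
  exact: (congr1 (fun s => s n) (esym e)).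
have G1 : cinv (log_genus c) 1%N != 0.
  by rewrite -[_ 1%N]/(invlog_over_z c 0%N) invlog_over_z0 ?oner_neq0.
rewrite eG in lG'; have el := scomp_sX_inj _ _ _ G0 G1 lG lG'.
apply: functional_extensionality => n.
have := congr1 (fun s => s n.+1 * n.+1%:R) el.
by rewrite /log_genus /= !divfK.
Qed.

End Genus.

Theorem A_genus_representation (F : fieldType) (c : nat -> F) :
  (forall n, n.+1%:R != 0 :> F) -> c 0%N = 1 ->
    [/\ tau1 (A_genus c) != 0,
        Stransform (distr (A_genus c)) = Q_genus c
      & forall c' : nat -> F, c' 0%N = 1 -> c <> c' ->
          (exists m n, coefE1 (A_genus c) m n <> coefE1 (A_genus c') m n)
          /\ distr (A_genus c) <> distr (A_genus c')].
Proof.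
move=> hchar c0.
have g0 (c1 : nat -> F) : c1 0%N = 1 -> invlog_over_z c1 0%N != 0.
  by move=> c10; rewrite invlog_over_z0 ?oner_neq0.
have S_Q (c1 : nat -> F) : c1 0%N = 1 -> Stransform (distr (A_genus c1)) = Q_genus c1.
  by move=> c10; rewrite A_genusE Stransform_Aop ?g0.
split; [by rewrite /tau1 coefE1_A_genus g0 | exact: S_Q |].
move=> c' c'0 neq; split.
- apply: NNPP => no_diff; apply: neq; apply: invlog_over_z_inj => //.
  apply: functional_extensionality => n; apply: NNPP => hn.
  by apply: no_diff; exists 0%N, n; rewrite !coefE1_A_genus.
- move=> same_distr; apply: neq; apply: invlog_over_z_inj => //.
  have eQ : Q_genus c = Q_genus c' by rewrite -(S_Q c c0) -(S_Q c' c'0) same_distr.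
  exact: (sinv_inj _ _ (g0 c c0) (g0 c' c'0) eQ).
Qed.

Local Open Scope complex_scope.
Theorem mainTheorem5 (R : realType) :
  forall c : nat -> R[i], c 0%N = 1 ->
    [/\ tau1 (A_genus c) != 0,
        Stransform (distr (A_genus c)) = Q_genus c
      & forall c' : nat -> R[i], c' 0%N = 1 -> c <> c' ->
          (exists m n, coefE1 (A_genus c) m n <> coefE1 (A_genus c') m n)
          /\ distr (A_genus c) <> distr (A_genus c')].
Proof. by move=> c; apply: A_genus_representation => n; rewrite pnatr_eq0. Qed.
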